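(* Let $G_\ell=H_\ell\ltimes V_\ell$, where $(H_\ell,V_\ell)$ satisfies the dual orbit condition of depth $\ell\ge1$, with associated closed subgroups $Q_j,V_j$ ($j=\ell,\dots,1$). Let $P_\ell$ and $N_\ell$ be the subgroups of $G_\ell$ generated respectively by $Q_\ell,\dots,Q_1$ and by $V_\ell,\dots,V_1$. Then $G_\ell=P_\ell\bowtie N_\ell$, i.e. $(P_\ell,N_\ell)$ is a matched pair for $G_\ell$.
   Context: All groups are second countable locally compact. A semidirect product $G_1\ltimes G_2$ contains $G_1,G_2$ as closed subgroups with $G_2$ normal. A pair $(G_1,G_2)$ of closed subgroups of $G$ is a *matched pair* for $G$ (written $G=G_1\bowtie G_2$) if $G_1\cap G_2=\{e\}$ and $G_1G_2$ has full measure in $G$. For $V$ abelian, $\hat V$ is its Pontryagin dual with pairing $e^{i\langle\xi,v\rangle}$; an action of $H$ on $V$ by automorphisms induces the dual action $e^{i\langle h^\flat\xi,v\rangle}=e^{i\langle\xi,h^{-1}.v\rangle}$ on $\hat V$. **Dual orbit condition.** Let $H,V$ be nontrivial, $V$ abelian, with a continuous homomorphism $H\to\mathrm{Aut}(V)$. $(H,V)$ satisfies $\mathrm{DOC}_1$ if there is $\xi_0\in\hat V$ such that $H\to\hat V$, $q\mapsto q^\flat\xi_0$, is a measure class isomorphism. It satisfies $\mathrm{DOC}_\ell$, $\ell\ge2$, if (1) there is $\xi_0\in\hat V$ whose $H$-orbit has full measure and whose stabilizer in $H$ is of the form $G'=H'\ltimes V'$ with $V'$ abelian; (2) there is a closed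 subgroup $Q\subset H$ such that $(Q,G')$ is a matched pair for $H$ and $H'$ normalizes $Q$; (3) $(H',V')$ satisfies $\mathrm{DOC}_{\ell-1}$. **Data.** Unravelling the induction gives closed subgroups $G_j,H_j,V_j,Q_j$ of $G_\ell$ ($j=\ell,\dots,1$) with $V_j$ abelian, $G_j=H_j\ltimes V_j$, $H_j=Q_j\bowtie G_{j-1}$ (with $H_1=Q_1$), $H_{j-1}$ normalizing $Q_j$, and $\xi_{0,j}\in\hat V_j$ in the full-measure $H_j$-orbit with $G_{j-1}=\mathrm{Stab}_{H_j}(\xi_{0,j})$. Consequently $N_\ell=N_{\ell-1}\ltimes V_\ell$ and $P_\ell=P_{\ell-1}\ltimes Q_\ell$ are iterated semidirect products. *)

(* Defs.v *)
From HB Require Import structures.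
From mathcomp Require Import all_boot all_order all_algebra.
From mathcomp Require Import all_classical all_reals all_analysis.
From mathcomp Require Import complex.

Set Implicit Arguments.
Unset Strict Implicit.
Unset Printing Implicit Defensive.

Import Order.TTheory GRing.Theory Num.Theory.
Import numFieldNormedType.Exports.

Local Open Scope classical_set_scope.
Local Open Scope ring_scope.
Local Open Scope group_scope.

(* The point is irrelevant to everything below: it is only there because
   generated sigma-algebras are measurable types on pointed types only. *)
#[short(type="preTopologicalGroupType")]
HB.structure Definition PreTopologicalGroup :=
  {G of PointedTopological G & Group G}.

HB.mixin Record PreTopologicalGroup_isTopologicalGroup G
    & PreTopologicalGroup G := {
  mulg_continuous : continuous (fun x : G * G => x.1 * x.2) ;
  invg_continuous : continuous (fun x : G => x^-1) }.

#[short(type="topologicalGroupType")]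
HB.structure Definition TopologicalGroup :=
  {G of PreTopologicalGroup G & PreTopologicalGroup_isTopologicalGroup G}.

HB.mixin Record TopologicalGroup_isLcsc G & TopologicalGroup G := {
  lcsc_hausdorff : hausdorff_space G ;
  lcsc_locally_compact : locally_compact [set: G] ;
  lcsc_second_countable : @second_countable G }.

(* "lcsc" = (Hausdorff) locally compact second countable. *)
#[short(type="lcscGroupType")]
HB.structure Definition LcscGroup :=
  {G of TopologicalGroup G & TopologicalGroup_isLcsc G}.

Notation borel G := (g_sigma_algebraType (@open G)).

Section haar.
Context (R : realType) (G : preTopologicalGroupType).

(* No continuity of the operations is required in this definition, so that it
   applies to the Pontryagin dual below without first proving that the latter
   is a locally compact group.
   On a second countable locally compact Hausdorff group, a Borel measure that
   is finite on compact sets is automatically regular, so this is the usual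
   notion of left Haar measure. *)
Definition left_haar (mu : {measure set (borel G) -> \bar R}) : Prop :=
  [/\ mu [set: G] <> 0%E,
      (forall K : set G, compact K -> (mu K < +oo)%E) &
      (forall (g : G) (A : set (borel G)), measurable A ->
         mu [set g * x | x in A] = mu A)].

(* Left Haar measures exist and are unique up to a positive factor on locally
   compact groups, so "for all" amounts to "for one" here. *)
Definition haar_null (A : set G) : Prop :=
  forall mu : {measure set (borel G) -> \bar R},
    left_haar mu -> mu.-negligible (A : set (borel G)).

Definition full_measure (A : set G) : Prop := haar_null (~` A).

End haar.

(* Both groups carry the class of their Haar measures; f becomes a Borel
   isomorphism between subsets of full measure, and identifies the null sets. *)
Definition measure_class_iso (R : realType) (X Y : preTopologicalGroupType)
    (f : X -> Y) : Prop :=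
  [/\ measurable_fun [set: borel X] (f : borel X -> borel Y),
      (exists (X0 : set (borel X)) (Y0 : set (borel Y)),
        [/\ measurable X0 /\ measurable Y0,
            full_measure R (X0 : set X) /\ full_measure R (Y0 : set Y),
            set_bij X0 Y0 f &
            forall A : set (borel X), measurable A -> A `<=` X0 ->
              measurable (f @` A : set (borel Y))]) &
      (forall B : set (borel Y), measurable B ->
        haar_null R (f @^-1` B : set X) <-> haar_null R (B : set Y))].

Section subgroups.
Context (G : groupType).

Definition subgroup (A : set G) : Prop :=
  [/\ A 1, (forall x y, A x -> A y -> A (x * y)) &
      (forall x, A x -> A x^-1)].

Definition generated (A : set G) : set G := smallest subgroup A.

Definition normalizes (A B : set G) : Prop :=
  forall x y, A x -> B y -> B (x * y * x^-1).

End subgroups.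

Definition closed_subgroup (G : preTopologicalGroupType) (A : set G) : Prop :=
  subgroup A /\ closed A.

Definition matched_pair (R : realType) (G : preTopologicalGroupType)
    (A B : set G) : Prop :=
  [/\ closed_subgroup A, closed_subgroup B, A `&` B = [set 1] &
      full_measure R [set a * b | a in A & b in B]].

(* A closed subgroup of G that has to be regarded as a group in its own right
   is given as the range of such a map. *)
Definition closed_embedding (K G : preTopologicalGroupType) (f : K -> G)
    : Prop :=
  [/\ {morph f : x y / x * y}, injective f, continuous f &
      forall A : set K, closed A -> closed (f @` A)].

(* Continuous homomorphisms H -> Aut(V). For V locally compact, continuity for
   the usual topology of Aut(V) is joint continuity of H x V -> V. *)
Record autAction (H V : lcscGroupType) := AutAction {
  act_fun :> H -> V -> V ;
  act1 : forall v, act_fun 1 v = v ;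
  actM : forall g h v, act_fun (g * h) v = act_fun g (act_fun h v) ;
  act_morph : forall h, {morph act_fun h : v w / v * w} ;
  act_continuous : continuous (fun x : H * V => act_fun x.1 x.2) }.

(* Internal semidirect product: G is the product of the closed subgroups i(H)
   and j(V), and j(V) is normal, h acting on it by conjugation. *)
Definition semidirect (G H V : lcscGroupType) (act : autAction H V)
    (i : H -> G) (j : V -> G) : Prop :=
  [/\ closed_embedding i /\ closed_embedding j,
      (forall h v, i h * j v * (i h)^-1 = j (act h v)),
      range i `&` range j = [set 1] &
      [set a * b | a in range i & b in range j] = [set: G]].

Definition Cplx (R : realType) : numFieldType := R[i].

(* Pontryagin dual: continuous homomorphisms to the unit circle (the value at v
   is the pairing exp(i<xi,v>)), with pointwise product and the compact-open
   topology. *)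
Section dual.
Context (R : realType) (V : lcscGroupType).

Record dual : Type := Dual {
  dual_fun :> V -> Cplx R ;
  dual_continuous : continuous dual_fun ;
  dual_norm : forall v, (`|dual_fun v| = 1)%R ;
  dualM : forall v w, dual_fun (v * w) = (dual_fun v * dual_fun w)%R }.

Lemma dual_ext (x y : dual) : x =1 y -> x = y.
Proof.
case: x y => [x cx nx mx] [y cy ny my] /= /funext xy; subst y.
by congr Dual; exact: Prop_irrelevance.
Qed.

Lemma dual_neq0 (x : dual) v : x v != 0%R.
Proof. by rewrite -normr_eq0 dual_norm oner_eq0. Qed.

Lemma dual_one_continuous : continuous (fun _ : V => 1%R : Cplx R).
Proof. by move=> v; exact: cvg_cst. Qed.

Definition dual_one : dual :=
  Dual dual_one_continuous (fun=> normr1 (Cplx R)) (fun _ _ => esym (mulr1 1%R)).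

Section operations.
Variables x y : dual.

Lemma dual_mul_continuous : continuous (fun v => (x v * y v)%R).
Proof. by move=> v; apply: cvgM; exact: dual_continuous. Qed.

Lemma dual_mul_norm v : (`|x v * y v| = 1)%R.
Proof. by rewrite normrM !dual_norm mulr1. Qed.

Lemma dual_mulM v w :
  (x (v * w)%g * y (v * w)%g = x v * y v * (x w * y w))%R.
Proof. by rewrite !dualM mulrACA. Qed.

Definition dual_mul : dual := Dual dual_mul_continuous dual_mul_norm dual_mulM.

Lemma dual_inv_continuous : continuous (fun v => (x v)^-1%R).
Proof.
by move=> v; apply: cvgV; [exact: dual_neq0 | exact: dual_continuous].
Qed.

Lemma dual_inv_norm v : (`|(x v)^-1| = 1)%R.
Proof. by rewrite normfV dual_norm invr1. Qed.

Lemma dual_invM v w : ((x (v * w)%g)^-1 = (x v)^-1 * (x w)^-1)%R.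
Proof. by rewrite dualM invfM. Qed.

Definition dual_inv : dual := Dual dual_inv_continuous dual_inv_norm dual_invM.

End operations.

Lemma dual_mulA : associative dual_mul.
Proof. by move=> x y z; apply: dual_ext => v; exact: mulrA. Qed.

Lemma dual_mul1 : left_id dual_one dual_mul.
Proof. by move=> x; apply: dual_ext => v; exact: mul1r. Qed.

Lemma dual_mul1r : right_id dual_one dual_mul.
Proof. by move=> x; apply: dual_ext => v; exact: mulr1. Qed.

Lemma dual_mulV : left_inverse dual_one dual_inv dual_mul.
Proof. by move=> x; apply: dual_ext => v; apply: mulVf; exact: dual_neq0. Qed.

Lemma dual_mulVr : right_inverse dual_one dual_inv dual_mul.
Proof. by move=> x; apply: dual_ext => v; apply: mulfV; exact: dual_neq0. Qed.

HB.instance Definition _ := gen_eqMixin dual.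
HB.instance Definition _ := gen_choiceMixin dual.
HB.instance Definition _ := isPointed.Build dual dual_one.
HB.instance Definition _ := isGroup.Build dual
  dual_mulA dual_mul1 dual_mul1r dual_mulV dual_mulVr.
HB.instance Definition _ := Topological.copy dual
  (@initial_topology dual {compact-open, V -> Cplx R} dual_fun).

End dual.

Section dual_action.
Context (R : realType) (H V : lcscGroupType) (act : autAction H V).

Section dual_act.
Variables (h : H) (xi : dual R V).

Lemma dual_act_continuous : continuous (fun v => xi (act h^-1 v)).
Proof.
move=> v; apply: continuous_comp; last exact: dual_continuous.
apply: (@continuous_comp _ _ _ (fun w => (h^-1, w)) (fun x => act x.1 x.2)).
  by apply: cvg_pair => /=; [exact: cvg_cst | exact: cvg_id].
exact: act_continuous.
Qed.

Lemma dual_actM v w :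
  xi (act h^-1 (v * w)) = (xi (act h^-1 v)%g * xi (act h^-1 w)%g)%R.
Proof. by rewrite act_morph dualM. Qed.

Definition dual_act : dual R V :=
  Dual dual_act_continuous (fun v => dual_norm xi (act h^-1 v)) dual_actM.

End dual_act.

Definition dual_orbit (xi : dual R V) : set (dual R V) :=
  range (fun h => dual_act h xi).

Definition dual_stab (xi : dual R V) : set H := [set h | dual_act h xi = xi].

End dual_action.

Definition nontrivial (G : groupType) : Prop := exists x : G, x <> 1.

Definition abelian_group (G : groupType) : Prop :=
  forall x y : G, x * y = y * x.

(* [DOC R l act Q W]: (H, V) satisfies the dual orbit condition of depth l, with
   associated closed subgroups Q = [:: Q_l; ...; Q_1] and
   W = [:: V_(l-1); ...; V_1], all viewed in H (whereas V_l is V itself).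
   In depth > 1, k is the inclusion in H of G' = H' |x V', and the subgroups
   associated with (H', V') are transported to H along H' -> G' -> H. *)
Fixpoint DOC (R : realType) (l : nat) (H V : lcscGroupType)
    (act : autAction H V) (Q W : seq (set H)) {struct l} : Prop :=
  [/\ nontrivial H, nontrivial V, abelian_group V &
  match l with
  | 0 => False
  | l'.+1 => if l' is 0 then
      [/\ exists xi0 : dual R V,
            measure_class_iso R (fun q : H => dual_act act q xi0),
          Q = [:: [set: H]] &
          W = [::]]
    else
      exists (xi0 : dual R V)
        (G' H' V' : lcscGroupType) (act' : autAction H' V')
        (k : G' -> H) (i : H' -> G') (j : V' -> G')
        (Q0 : set H) (Q' W' : seq (set H')),
      [/\ [/\ full_measure R (dual_orbit act xi0),
              closed_embedding k,
              range k = dual_stab act xi0 &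
              semidirect act' i j],
          matched_pair R Q0 (range k) /\ normalizes (range (k \o i)) Q0,
          DOC R l' act' Q' W',
          Q = Q0 :: [seq (k \o i) @` A | A <- Q'] &
          W = range (k \o j) :: [seq (k \o i) @` A | A <- W']]
  end].

(* Main.v *)
Require Import Defs.
From HB Require Import structures.
From mathcomp Require Import all_boot all_order all_algebra.
From mathcomp Require Import all_classical all_reals all_analysis.

(* Put G' = H' |x V' inside H and let (P', N') be the matched pair of G'
   obtained by induction.  Then P = Q_l k(P') and N = k(N') V_l inside G, and
   the algebraic part of the claim is immediate.

   Full measure: if C is a compact subset of Q_l, then S |-> mu(k(S) C) is zero
   or a left Haar measure of G', so Z Q_l is null in H for every null Z in G';
   since inversion preserves null sets (Tonelli), Q_l Z is null as well.  The
   same argument passes from H to G.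

   Closedness of P: the closure L of Q_l k(P') normalizes Q_l, and any two
   conull sets meet, which forces L = Q_l (L `&` k(G')).  By Baire's theorem L
   is, near each of its points, contained in Q_l K for some compact subset K of
   L `&` k(G'), so Q_l C is closed for every closed subset C of L `&` k(G').

   "Conull sets meet" would fail if H had no Haar measure, full measure being
   then vacuous, so the existence of Haar measure is essential: the limit of the
   ratios (K : U) / (K0 : U) of covering numbers along an ultrafilter of
   neighbourhoods U of 1 is a content on compact sets, which induces an outer
   measure for which the open sets are Caratheodory measurable. *)

Set Implicit Arguments.
Unset Strict Implicit.
Unset Printing Implicit Defensive.

Local Open Scope classical_set_scope.

Import Order.TTheory GRing.Theory Num.Theory.
Import numFieldNormedType.Exports.

(** * Closed products in locally compact groups *)

Local Notation "A ** B" := [set (a * b)%g | a in A & b in B]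
  (at level 40, left associativity) : classical_set_scope.

Section topological_group.
Local Open Scope group_scope.
Context (G : topologicalGroupType).
Implicit Types (A B C K : set G).

Lemma continuous_mulg (T : topologicalType) (f g : T -> G) (x : T) :
  {for x, continuous f} -> {for x, continuous g} ->
  {for x, continuous (fun t => f t * g t)}.
Proof.
move=> cf cg.
apply: (@continuous_comp _ _ _ (fun t => (f t, g t)) (fun z => z.1 * z.2)).
  exact: cvg_pair.
exact: mulg_continuous.
Qed.

Lemma continuous_invg (T : topologicalType) (f : T -> G) (x : T) :
  {for x, continuous f} -> {for x, continuous (fun t => (f t)^-1)}.
Proof. by move=> cf; apply: (continuous_comp cf); exact: invg_continuous. Qed.

Lemma continuous_lmul (g : G) : continuous (fun x : G => g * x).
Proof. by move=> x; apply: continuous_mulg; [exact: cvg_cst | exact: cvg_id]. Qed.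

Lemma continuous_rmul (g : G) : continuous (fun x : G => x * g).
Proof. by move=> x; apply: continuous_mulg; [exact: cvg_id | exact: cvg_cst]. Qed.

Lemma lmul_preimage (g : G) A : [set g * x | x in A] = (fun x => g^-1 * x) @^-1` A.
Proof.
apply/seteqP; split=> [_ [x Ax <-]|x /= Ax]; first by rewrite /= mulKg.
by exists (g^-1 * x) => //; rewrite mulVKg.
Qed.

Lemma invg_preimage A : [set x^-1 | x in A] = (fun x => x^-1) @^-1` A.
Proof.
apply/seteqP; split=> [_ [x Ax <-]|x /= Ax]; first by rewrite /= invgK.
by exists (x^-1) => //; rewrite invgK.
Qed.

Lemma lmul_open (g : G) A : open A -> open [set g * x | x in A].
Proof.
by rewrite lmul_preimage; apply: open_comp => x _; exact: continuous_lmul.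
Qed.

Lemma lmul_compact (g : G) K : compact K -> compact [set g * x | x in K].
Proof.
move=> cK; apply: continuous_compact => //.
by apply: continuous_subspaceT; exact: continuous_lmul.
Qed.

(** For [y] outside [A ** K] every [y * k^-1] avoids the closed set [A]; compactness of [K] makes
    this persist for all [k] at once on a neighbourhood of [y]. *)
Lemma closed_mul_compact A K : closed A -> compact K -> closed (A ** K).
Proof.
move=> cA /compact_near_coveringP cK.
rewrite -[A ** K]setCK; apply: open_closedC; rewrite openE => y yAK.
have : \near y, K `<=` [set k | ~ A (y * k^-1)].
  apply: cK => k Kk.
  have : nbhs (k, y) ((fun z : G * G => z.2 * z.1^-1) @^-1` (~` A)).
    have c : {for (k, y), continuous (fun z : G * G => z.2 * z.1^-1)}.
      apply: continuous_mulg; first exact: cvg_snd.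
      by apply: continuous_invg; exact: cvg_fst.
    apply: c; apply: open_nbhs_nbhs; split; first exact: closed_openC.
    by move=> /= Ayk; apply: yAK; exists (y * k^-1) => //; exists k; rewrite ?mulgVK.
  by [].
apply: filterS => z zK [a Aa [k Kk azk]].
by apply: (zK k Kk); rewrite /= -azk mulgK.
Qed.

Lemma compact_mul A K : compact A -> compact K -> compact (A ** K).
Proof.
move=> cA cK.
have -> : A ** K = (fun z : G * G => z.1 * z.2) @` (A `*` K).
  apply/seteqP; split=> [_ [a Aa [k Kk <-]]|_ [[a k] [/= Aa Kk] <-]].
    by exists (a, k).
  by exists a => //; exists k.
apply: continuous_compact; last exact: compact_setX.
by apply: continuous_subspaceT; exact: mulg_continuous.
Qed.

Lemma nbhs_lmul (g x : G) (U : set G) : nbhs x U -> nbhs (g * x) [set g * y | y in U].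
Proof.
rewrite lmul_preimage => Ux.
have := @continuous_lmul g^-1 (g * x) U; rewrite mulKg; exact.
Qed.

Lemma closure_subgroup A : subgroup A -> subgroup (closure A).
Proof.
move=> [A1 AM AV]; split; first exact: subset_closure.
- move=> x y Ax Ay U Uxy.
  have /= [[U1 U2] /= [xU1 yU2] U12] := @mulg_continuous G (x, y) U Uxy.
  have [a [Aa U1a]] := Ax _ xU1; have [b [Ab U2b]] := Ay _ yU2.
  by exists (a * b); split; [exact: AM | exact: (U12 (a, b))].
- move=> x Ax U Ux; have [a [Aa Ua]] := Ax _ (@invg_continuous G x U Ux).
  by exists (a^-1); split => //; exact: AV.
Qed.

End topological_group.

(** * Baire category and closed products in locally compact second countable groups *)

Section lcsc.
Local Open Scope group_scope.
Context (G : lcscGroupType).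
Implicit Types (A B C K : set G).

Lemma compact_closedG K : compact K -> closed K.
Proof. exact: compact_closed (@lcsc_hausdorff G). Qed.

Lemma compact_nbhs (x : G) : exists2 K : set G, nbhs x K & compact K.
Proof.
have := @lcsc_locally_compact G x Logic.I.
case=> K; rewrite /within/= => nK [cK _]; exists K => //.
by apply: filterS nK => y; apply.
Qed.

Lemma compact_nbhs_sub (x : G) (U : set G) : nbhs x U ->
  exists V : set G, [/\ open V, V x, compact (closure V) & closure V `<=` U].
Proof.
move=> Ux; have [K Kx cK] := compact_nbhs x.
have [V Vx VU] := @compact_regular G x K (@lcsc_hausdorff G) cK Kx (U `&` K)
  (filterI Ux Kx).
exists V°; split; first exact: open_interior.
- exact: Vx.
- apply: (subclosed_compact _ cK); first exact: closed_closure.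
  by move=> y /(closureS (@interior_subset _ V)) /VU [].
- by move=> y /(closureS (@interior_subset _ V)) /VU [].
Qed.

Lemma countable_base : exists e : nat -> set G,
  (forall n, open (e n)) /\
  forall x U, nbhs x U -> exists n, e n x /\ e n `<=` U.
Proof.
have [B /countable_injP [f finj] [Bo Bb]] := @lcsc_second_countable G.
pose e n := \bigcup_(U in [set U | B U /\ f U = n]) U.
have eE U : B U -> e (f U) = U.
  move=> BU; apply/seteqP; split=> [x [U' [BU' ff]]|x Ux]; last by exists U.
  by rewrite (finj _ _ _ _ ff)// inE.
exists e; split=> [n|x U /Bb [V [BV Vx] VU]].
  by apply: bigcup_open => U [/Bo].
by exists (f V); rewrite eE.
Qed.

Lemma sigma_compact : exists K : nat -> set G,
  (forall n, compact (K n)) /\ \bigcup_n K n = [set: G].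
Proof.
have [e [eo eb]] := countable_base.
exists (fun n => if pselect (compact (closure (e n))) then closure (e n) else set0).
split=> [n|]; first by case: pselect => // ?; exact: compact0.
apply/seteqP; split=> // x _; have [K Kx cK] := compact_nbhs x.
have [n [enx enK]] := eb _ _ Kx; exists n => //.
have cn : compact (closure (e n)).
  apply: (subclosed_compact _ cK); first exact: closed_closure.
  by rewrite ((closure_id K).1 (compact_closedG cK)); exact: closureS.
by case: pselect => // ?; apply: subset_closure.
Qed.

Lemma closed_sigma_compact B : closed B -> exists K : nat -> set G,
  (forall n, compact (K n)) /\ \bigcup_n K n = B.
Proof.
move=> cB; have [K [cK KT]] := sigma_compact.
exists (fun n => K n `&` B); split=> [n|]; first exact: compact_closedI.
by rewrite -setI_bigcupl KT setTI.
Qed.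

(** Baire's theorem relative to [L]. If no [C n] contained a nonempty relatively open piece of [L],
    nested open sets meeting [L], with compact closures that avoid the [C n] in turn, would lead to
    a point of [L] outside every [C n]. *)
Lemma baire_closed (L : set G) (C : nat -> set G) :
  closed L -> L !=set0 -> L `<=` \bigcup_n C n -> (forall n, closed (C n)) ->
  exists n x, L x /\ exists2 U, nbhs x U & L `&` U `<=` C n.
Proof.
move=> cL [x0 Lx0] LC cC; apply: contrapT => noint.
pose good (O : set G) := open O /\ O `&` L !=set0.
(* The hypothesis [good] sits under the existential, so that choice yields a total function [f] to
   iterate. *)
have step (nO : nat * set G) : exists O' : set G, good nO.2 ->
    [/\ good O', compact (closure O') & closure O' `<=` nO.2 `\` C nO.1].
  have [[Oo [x [Ox Lx]]]|] := pselect (good nO.2); last by exists set0.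
  have [y [Ly Oy Cy]] : exists y, [/\ L y, nO.2 y & ~ C nO.1 y].
    apply: contrapT => h; apply: noint; exists nO.1, x; split => //.
    exists nO.2; first exact: open_nbhs_nbhs.
    by move=> y [Ly Oy]; apply: contrapT => nC; apply: h; exists y.
  have [V [Vo Vy cV VU]] : exists V : set G,
     [/\ open V, V y, compact (closure V) & closure V `<=` nO.2 `\` C nO.1].
    apply: compact_nbhs_sub; apply: open_nbhs_nbhs; split => //.
    by apply: openI => //; exact: closed_openC.
  by exists V => _; split => //; split => //; exists y.
have {step} [f fP] := choice step.
pose O := fix O n := if n is n'.+1 then f (n', O n') else [set: G].
have gO n : good (O n).
  elim: n => [|n IH] /=; first by split; [exact: openT | exists x0].
  by have [] := fP (n, O n) IH.
have OS n : [/\ compact (closure (O n.+1)) & closure (O n.+1) `<=` O n `\` C n].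
  by have [] := fP (n, O n) (gO n).
have Odec n m : (n <= m)%N -> O m `<=` O n.
  elim: m => [|m IH]; first by rewrite leqn0 => /eqP ->.
  rewrite leq_eqVlt => /predU1P[->//|/IH]; apply: subset_trans.
  by apply: subset_trans (@subset_closure _ _) _ => z /(OS m).2 [].
have [x xP] : exists x : nat -> G, forall n, (O n `&` L) (x n).
  by have [x] := choice (fun n => (gO n).2); exists x.
have [c1 _] := OS 0%N.
have [|p [_ px]] := c1 (x @ \oo) _.
  by exists 1%N => // n /= n1; apply: subset_closure; exact: (Odec _ _ n1 _ (xP n).1).
have pO n : closure (O n) p.
  move=> U Up; apply: px => //; exists n => // m /= nm.
  exact: (Odec _ _ nm _ (xP m).1).
have Lp : L p.
  by apply: cL => U Up; apply: px => //; exists 0%N => // m _; exact: (xP m).2.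
have [n _ Cnp] := LC _ Lp.
by have [_ /(_ p (pO n.+1))[]] := OS n.
Qed.

(** If [A ** B] is near 1 contained in [A ** K'], then near [y = a0 * b0] it is contained in [A]
    times [b0 K'], as [B] normalizes [A]. Factorizations are unique, so near [y] only the part [D]
    of [C] in [b0 K'] matters; it is compact, and [closed_mul_compact] applies. *)
Lemma closed_product A B C : closed_subgroup A -> closed_subgroup B ->
  A `&` B = [set 1] -> closed (A ** B) -> subgroup (A ** B) ->
  normalizes B A -> closed C -> C `<=` B -> closed (A ** C).
Proof.
move=> [[A1 AM AV] cA] [[B1 BM BV] cB] AB1 cAB [_ LM LV] nBA cC CB.
have uniqAB a b a' b' : A a -> B b -> A a' -> B b' -> a * b = a' * b' -> b = b'.
  move=> Aa Bb Aa' Bb' e.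
  have : (A `&` B) (a'^-1 * a).
    split; first by apply: AM => //; exact: AV.
    suff -> : a'^-1 * a = b' * b^-1 by apply: BM => //; exact: BV.
    by apply: (mulIg b); rewrite mulgVK -mulgA e mulKg.
  rewrite AB1 => /= e1; apply: (mulgI a); rewrite e; congr (_ * _).
  by apply: (mulgI a'^-1); rewrite mulVg e1.
have [K [cK KB]] := closed_sigma_compact cB.
have KsB n : K n `<=` B by rewrite -KB => x; exists n.
(* By Baire some A K_n has interior in A B; translating, A B is near 1 covered
   by A K' with K' compact. *)
have [K' [cK' K'B [U U1 UK]]] : exists K' : set G, [/\ compact K', K' `<=` B &
    exists2 U, nbhs 1 U & U `&` (A ** B) `<=` A ** K'].
  have [|||n [x [[a Aa [b Bb abx]] [U Ux UK]]]] :=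
    @baire_closed (A ** B) (fun n => A ** K n) cAB.
  - by exists 1; exists 1 => //; exists 1; rewrite ?mulg1.
  - move=> _ [a Aa [b Bb <-]]; move: Bb; rewrite -{1}KB => -[n _ Kb].
    by exists n => //; exists a => //; exists b.
  - by move=> n; exact: closed_mul_compact.
  exists [set b^-1 * k | k in K n]; split; first exact: lmul_compact.
    by move=> _ [k /KsB Bk <-]; apply: BM => //; exact: BV.
  exists [set x^-1 * u | u in U]; first by have := nbhs_lmul x^-1 Ux; rewrite mulVg.
  move=> _ [[u Uu <-] [a1 Aa1 [b1 Bb1 e]]].
  have [|a2 Aa2 [k Kk e2]] := UK u.
    split => //; exists (a * (b * a1 * b^-1)); first by apply: AM => //; exact: nBA.
    exists (b * b1); first exact: BM.
    by rewrite -!mulgA mulKg e mulgA abx mulVKg.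
  exists (b^-1 * (a^-1 * a2) * b^-1^-1).
    by apply: nBA; [exact: BV | apply: AM => //; exact: AV].
  exists (b^-1 * k); first by exists k.
  by rewrite invgK -e2 -abx invgM -!mulgA mulVKg.
move=> y yAC.
have [a0 Aa0 [b0 Bb0 ey]] : (A ** B) y.
  apply: cAB; apply: closureS yAC => _ [a Aa [c Cc <-]].
  by exists a => //; exists c => //; exact: CB.
pose D := C `&` [set b0 * k | k in K'].
have cD : closed (A ** D).
  apply: closed_mul_compact => //; rewrite /D setIC.
  by apply: compact_closedI => //; exact: lmul_compact.
suff : closure (A ** D) y by move=> /cD [a Aa [c [Cc _]] <-]; exists a => //; exists c.
move=> W Wy.
have [|z [[a Aa [c Cc azc]] [Wz [u Uu yuz]]]] := yAC (W `&` [set y * u | u in U]).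
  by apply: filterI => //; have := nbhs_lmul y U1; rewrite mulg1.
have Bc := CB _ Cc.
have [|a1 Aa1 [k Kk e]] := UK u.
  split => //; rewrite (_ : u = y^-1 * (a * c)); last by rewrite azc -yuz mulKg.
  apply: LM; first by apply: LV; exists a0 => //; exists b0.
  by exists a => //; exists c.
have ebk : a * c = (a0 * (b0 * a1 * b0^-1)) * (b0 * k).
  by rewrite azc -yuz -ey -e -!mulgA mulKg.
have cbk : c = b0 * k.
  apply: uniqAB ebk => //; first by apply: AM => //; exact: nBA.
  by apply: BM => //; exact: K'B.
exists z; split => //; exists a => //; exists c => //; split => //.
by exists k.
Qed.

End lcsc.

(** * Haar measure from an invariant content *)

Section compact_sets.
Local Open Scope group_scope.
Context (G : lcscGroupType).
Implicit Types (A B K L : set G).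

(** [S W D] collects the points of [K] whose translate of [W] stays in [D]. For a small
    neighbourhood [W] of 1, [S W A] and [S W B] cover [K] by compactness, and their closures remain
    in [A] and in [B]. *)
Lemma compact_split K A B : compact K -> open A -> open B -> K `<=` A `|` B ->
  exists K1 K2 : set G,
    [/\ compact K1, compact K2, K1 `<=` A, K2 `<=` B & K `<=` K1 `|` K2].
Proof.
move=> cK oA oB KAB.
pose S (W D : set G) := [set x | K x /\ forall w, W w -> D (x * w)].
(* Smallness of [W] is expressed by a filter on sets, the form in which the covering property of [K]
   yields one [W] for all points. *)
have near1 x (D : set G) : open D -> D x ->
    \forall x' \near x & W \near powerset_filter_from (nbhs (1 : G)),
      forall w, W w -> D (x' * w).
  move=> oD Dx; have Dx1 : nbhs (x * 1) D by rewrite mulg1; exact: open_nbhs_nbhs.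
  have /= [[U1 U2] /= [xU1 yU2] U12] := @mulg_continuous G (x, 1) D Dx1.
  exists (U1, [set W : set G | W `<=` U2]) => /=.
    by split => //; exact: small_set_sub.
  by move=> [x' W] /= [U1x' WU2] w Ww; apply: (U12 (x', w)); split => //=; exact: WU2.
have [W W1 WAB] : exists2 W, nbhs (1 : G) W & K `<=` S W A `|` S W B.
  apply/near_powerset_filter_fromP => [W W' WW' h x Kx|].
    by have [[_ hx]|[_ hx]] := h x Kx; [left|right]; split => // w /WW'; exact: hx.
  apply: (near_covering_withinP _).2 => // [|x Kx].
    exact/compact_near_coveringP.
  have [Ax|Bx] := KAB x Kx.
  - by apply: filterS (near1 x A oA Ax) => -[x' W] /= h Kx'; left.
  - by apply: filterS (near1 x B oB Bx) => -[x' W] /= h Kx'; right.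
have cS D : closure (S W D) `<=` D.
  move=> y; case/(_ [set z | W (z^-1 * y)]).
    have c : {for y, continuous (fun z : G => z^-1 * y)}.
      by apply: continuous_mulg; [apply: continuous_invg; exact: cvg_id | exact: cvg_cst].
    by apply: c; rewrite mulVg.
  by move=> z [[_ Sz] /Sz]; rewrite mulVKg.
exists (K `&` closure (S W A)), (K `&` closure (S W B)); split.
- exact: compact_closedI cK (@closed_closure _ _).
- exact: compact_closedI cK (@closed_closure _ _).
- by move=> x [_ /cS].
- by move=> x [_ /cS].
- by move=> x Kx; have [Sx|Sx] := WAB x Kx; [left|right]; split => //; exact: subset_closure.
Qed.

(** This makes covering numbers additive on disjoint compact sets: no translate of [U] meets both.
    For [u], [v] near 1, [x * (u^-1 * v)] avoids [L] uniformly in [x] from [K]. *)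
Lemma compact_separated K L : compact K -> compact L -> K `&` L = set0 ->
  exists2 U, nbhs (1 : G) U &
    forall g x y, K x -> L y -> U (g^-1 * x) -> U (g^-1 * y) -> False.
Proof.
move=> cK cL KL0.
have : \forall z \near ((1, 1) : G * G), K `<=` [set x | ~ L (x * (z.1^-1 * z.2))].
  have /compact_near_coveringP/(_ _ (nbhs ((1, 1) : G * G))
    (fun z x => ~ L (x * (z.1^-1 * z.2)))) h := cK.
  apply: h => x Kx.
  have c : {for (x, (1, 1)),
      continuous (fun z : G * (G * G) => z.1 * (z.2.1^-1 * z.2.2))}.
    apply: continuous_mulg; first exact: cvg_fst.
    have c2 : {for (x, (1, 1)), continuous (snd : G * (G * G) -> G * G)}.
      exact: cvg_snd.
    apply: continuous_mulg.
      apply: continuous_invg; apply: (continuous_comp c2); exact: cvg_fst.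
    by apply: (continuous_comp c2); exact: cvg_snd.
  apply: (c (~` L)); apply: open_nbhs_nbhs.
  split; first by apply: closed_openC; exact: compact_closedG.
  by rewrite /= mulVg mulg1 => Lx; have : (K `&` L) x by []; rewrite KL0.
move=> [[U1 U2] /= [U11 U21] U12]; exists (U1 `&` U2); first exact: filterI.
move=> g x y Kx Ly [U1x _] [_ U2y].
apply: (U12 (g^-1 * x, g^-1 * y) _ x Kx) => //=.
by rewrite invgM invgK -mulgA (mulgA g) mulgV mul1g mulVKg.
Qed.

End compact_sets.

Section content.
Context (R : realType) (G : lcscGroupType).
Implicit Types (A B K L O : set G).

(** A content in the sense of Halmos. The inequality in [content_lmul], applied to [g] and to
    [g^-1], gives equality. *)
Record invariant_content (c : set G -> R) : Prop := InvariantContent {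
  content_ge0 : forall K, compact K -> (0 <= c K)%R ;
  content_le : forall K L, compact K -> compact L -> K `<=` L -> (c K <= c L)%R ;
  content_leU : forall K L, compact K -> compact L ->
    (c (K `|` L) <= c K + c L)%R ;
  content_geU : forall K L, compact K -> compact L -> K `&` L = set0 ->
    (c K + c L <= c (K `|` L))%R ;
  content_lmul : forall g K, compact K ->
    (c [set (g * x)%g | x in K] <= c K)%R }.

Context (c : set G -> R) (cP : invariant_content c).

Definition inner_content O : \bar R :=
  ereal_sup [set (c K)%:E | K in [set K | compact K /\ K `<=` O]].

Definition outer_content A : \bar R :=
  ereal_inf [set inner_content O | O in [set O | open O /\ A `<=` O]].

Local Open Scope ring_scope.
Local Open Scope ereal_scope.

Lemma content0 : c set0 = 0%R.
Proof.
apply/eqP; rewrite eq_le (content_ge0 cP (@compact0 _)) andbT.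
have := content_geU cP (@compact0 G) (@compact0 G) (set0I _).
by rewrite set0U -lerBrDr subrr.
Qed.

Lemma inner_content_ge K O : compact K -> K `<=` O -> (c K)%:E <= inner_content O.
Proof. by move=> cK KO; apply: ereal_sup_ubound; exists K. Qed.

Lemma inner_content_ge0 O : 0 <= inner_content O.
Proof. by have := @inner_content_ge set0 O (@compact0 _) (@sub0set _ _); rewrite content0. Qed.

Lemma outer_content_le A O : open O -> A `<=` O -> outer_content A <= inner_content O.
Proof. by move=> oO AO; apply: ereal_inf_lbound; exists O. Qed.

Lemma outer_content_ge0 A : 0 <= outer_content A.
Proof. by apply: le_ereal_inf_tmp => _ [ O _ <-]; exact: inner_content_ge0. Qed.

Lemma outer_content0 : outer_content set0 = 0.
Proof.
apply/eqP; rewrite eq_le outer_content_ge0 andbT.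
apply: le_trans (outer_content_le (@open0 _) (@sub0set _ _)) _.
apply: ge_ereal_sup => _ [K [_ K0] <-]; move: K0.
by rewrite subset0 => ->; rewrite content0.
Qed.

Lemma outer_content_compact_ge K : compact K -> (c K)%:E <= outer_content K.
Proof. by move=> cK; apply: le_ereal_inf_tmp => _ [ O [_ KO] <-]; exact: inner_content_ge. Qed.

Lemma outer_content_compact_lty K : compact K -> outer_content K < +oo.
Proof.
move=> cK; have [V1 nV1 cV1] := compact_nbhs (1%g : G).
have cKV := compact_mul cK cV1.
(* [K ** V1] is compact and has [K] in its interior, so its content is a finite bound. *)
apply: (@le_lt_trans _ _ (inner_content (interior (K ** V1)))).
  apply: outer_content_le; first exact: open_interior.
  move=> x Kx; apply: (@filterS _ _ _ [set (x * y)%g | y in V1]).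
    by move=> _ [y Vy <-]; exists x => //; exists y.
  by have := nbhs_lmul x nV1; rewrite mulg1.
apply: (@le_lt_trans _ _ (c (K ** V1))%:E); last exact: ltry.
apply: ge_ereal_sup => _ [L [cL LO] <-]; rewrite lee_fin.
by apply: content_le => //; exact: subset_trans (@interior_subset _ _).
Qed.

(** By induction on [n]: [compact_split] separates a compact part inside the last open set from one
    inside the others. *)
Lemma inner_content_sum (O : nat -> set G) K n : (forall i, open (O i)) ->
  compact K -> K `<=` \bigcup_(i < n) O i ->
  (c K)%:E <= \sum_(0 <= i < n) inner_content (O i).
Proof.
move=> oO; elim: n K => [|n IH] K cK KO.
  rewrite big_nil (_ : K = set0) ?content0//.
  by rewrite -subset0 => x /KO [].
have [|||K1 [K2 [cK1 cK2 K1O K2O KK]]] :=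
    @compact_split G K (\bigcup_(i < n) O i) (O n) cK.
- exact: bigcup_open.
- exact: oO.
- move=> x /KO [i /= + Oix]; rewrite ltnS leq_eqVlt => /predU1P[<-|ni].
    by right.
  by left; exists i.
rewrite big_nat_recr//=; apply: (@le_trans _ _ ((c K1)%:E + (c K2)%:E)).
  rewrite -EFinD lee_fin; apply: le_trans (content_leU cP cK1 cK2).
  by apply: content_le => //; exact: compactU.
by apply: leeD; [exact: IH | exact: inner_content_ge].
Qed.

Lemma inner_content_bigcup (O : nat -> set G) : (forall i, open (O i)) ->
  inner_content (\bigcup_i O i) <= \sum_(i <oo) inner_content (O i).
Proof.
move=> oO; apply: ge_ereal_sup => _ [K [cK KO] <-].
have [D _ KD] : finite_subset_cover setT O K.
  by move: cK; rewrite compact_cover; apply.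
pose N := (\max_(i <- finmap.enum_fset D) i).+1%N.
apply: (@le_trans _ _ (\sum_(0 <= i < N) inner_content (O i))).
  apply: inner_content_sum => // x /KD [i /= iD Oix]; exists i => //=.
  by rewrite ltnS; apply: leq_bigmax_seq.
by apply: nneseries_lim_ge => i _ _; exact: inner_content_ge0.
Qed.

Lemma outer_content_subadditive A F : subset_sigma_subadditive outer_content A F.
Proof.
move=> AF; have [->|fin] := eqVneq (\sum_(n <oo) outer_content (F n)) +oo.
  by rewrite leey.
apply/lee_addgt0Pr => e e0.
have Ffin n : outer_content (F n) \is a fin_num.
  rewrite ge0_fin_numE ?outer_content_ge0//.
  apply: le_lt_trans (_ : \sum_(n <oo) outer_content (F n) < +oo); last by rewrite ltey.
  rewrite (@nneseriesD1 _ (outer_content \o F) n xpredT)//=; last first.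
    by move=> k _; exact: outer_content_ge0.
  by rewrite leeDl// nneseries_ge0// => k _ _; exact: outer_content_ge0.
have ex n : exists O, [/\ open O, F n `<=` O &
    inner_content O <= outer_content (F n) + (e / (2 ^ n.+1)%:R)%:E].
  have en : (0 < e / (2 ^ n.+1)%:R)%R by rewrite divr_gt0// ltr0n expn_gt0.
  have [_ [ O [oO FO] <-] lO] := lb_ereal_inf_adherent en (Ffin n).
  by exists O; split => //; exact: ltW.
have [ O OP] := choice ex.
apply: (@le_trans _ _ (inner_content (\bigcup_n O n))).
  apply: outer_content_le; first by apply: bigcup_open => n _; have [] := OP n.
  by move=> x /AF [n _ Fx]; exists n => //; have [_ + _] := OP n; apply.
apply: le_trans (inner_content_bigcup _) _; first by move=> n; have [] := OP n.
apply: le_trans (epsilon_trick _ _ (ltW e0)); last by move=> n; exact: outer_content_ge0.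
by apply: lee_nneseries => n _ => [_|]; [exact: inner_content_ge0 | have [] := OP n].
Qed.

(** This is the Caratheodory criterion for open sets. Inside an open [U] containing [A], approximate
    [U] within [O] by a compact [K], then the open set [U] minus [K], which contains [A] minus [O],
    by a compact [L]; contents add on the disjoint pair [K], [L]. *)
Lemma outer_content_open O A : open O ->
  outer_content (A `&` O) + outer_content (A `&` ~` O) <= outer_content A.
Proof.
move=> oO; apply: le_ereal_inf_tmp => _ [U [oU AU] <-].
apply: (@le_trans _ _ (inner_content (U `&` O) + outer_content (A `&` ~` O))).
  by apply: leeD2r; apply: outer_content_le; [exact: openI | exact: setSI].
have step K : compact K -> K `<=` U `&` O ->
    (c K)%:E + outer_content (A `&` ~` O) <= inner_content U.
  move=> cK KUO; apply: (@le_trans _ _ ((c K)%:E + inner_content (U `\` K))).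
    apply: leeD2l; apply: outer_content_le.
      by apply: openI => //; apply: closed_openC; exact: compact_closedG.
    by move=> x [Ax nOx]; split; [exact: AU | move=> /KUO []].
  rewrite -leeBrDl//; apply: ge_ereal_sup => _ [L [cL LUK] <-].
  rewrite leeBrDl// -EFinD.
  have KL0 : K `&` L = set0 by rewrite -subset0 => x [Kx /LUK []].
  apply: (@le_trans _ _ (c (K `|` L))%:E); first by rewrite lee_fin content_geU.
  apply: inner_content_ge; first exact: compactU.
  by move=> x [/KUO []|/LUK []].
have := outer_content_ge0 (A `&` ~` O).
case: (outer_content _) step => [m step _|step _|//].
  rewrite -leeBrDr//; apply: ge_ereal_sup => _ [K [cK KUO] <-].
  by rewrite leeBrDr// step.
(* If [A] has infinite outer content outside [O], the empty choice of [K] already forces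
   [inner_content U] to be infinite. *)
have := step set0 (@compact0 _) (@sub0set _ _).
by rewrite content0 add0e leye_eq => /eqP ->; rewrite leey.
Qed.

Lemma outer_content_lmul g A :
  outer_content [set (g * x)%g | x in A] = outer_content A.
Proof.
have le h B : outer_content [set (h * x)%g | x in B] <= outer_content B.
  apply: le_ereal_inf_tmp => _ [ O [oO BO] <-].
  apply: le_trans (outer_content_le (@lmul_open G h O oO) (image_subset _ BO)) _.
  apply: ge_ereal_sup => _ [K [cK KO] <-].
  have cK' := @lmul_compact G h^-1%g K cK.
  apply: (@le_trans _ _ (c [set (h^-1 * x)%g | x in K])%:E).
    rewrite lee_fin; apply: le_trans (@content_lmul c cP h _ cK').
    apply: content_le => //; first exact: lmul_compact.
    by move=> x Kx; exists (h^-1 * x)%g; rewrite ?mulVKg//; exists x.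
  by apply: inner_content_ge => // _ [x /KO [y Oy <-] <-]; rewrite mulKg.
apply/eqP; rewrite eq_le le /=.
rewrite [X in outer_content X <= _](_ : A =
    [set (g^-1 * x)%g | x in [set (g * x)%g | x in A]]).
  exact: le.
apply/seteqP; split=> [x Ax|_ [_ [x Ax <-] <-]]; last by rewrite mulKg.
by exists (g * x)%g; rewrite ?mulKg//; exists x.
Qed.

Lemma left_haar_of_content (K0 : set G) : compact K0 -> (0 < c K0)%R ->
  exists mu : {measure set (borel G) -> \bar R}, left_haar mu.
Proof.
move=> cK0 K00.
pose m : {outer_measure set G -> \bar R} := HB.pack outer_content
  (isSubsetOuterMeasure.Build R G outer_content outer_content0 outer_content_ge0
     outer_content_subadditive).
have mcara : <<s @open G >> `<=` m.-caratheodory.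
  apply: smallest_sub.
    exact: (@sigma_algebra_measurable _ (caratheodory_type m)).
  by move=> O oO; apply: le_caratheodory_measurable => X; exact: outer_content_open.
have madd : semi_sigma_additive (outer_content : set (borel G) -> _).
  move=> F mF tF mUF; apply: (@caratheodory_measure_sigma_additive R G m) => //.
    by move=> n; apply: mcara; exact: mF.
  exact: mcara mUF.
pose mu : {measure set (borel G) -> \bar R} := HB.pack
  (outer_content : set (borel G) -> \bar R)
  (isMeasure.Build _ _ _ (outer_content : set (borel G) -> \bar R)
     outer_content0 outer_content_ge0 madd).
exists mu; split=> [| |g A _]; last exact: outer_content_lmul.
- move=> muT; have : (c K0)%:E <= mu setT.
    by apply: le_trans (outer_content_compact_ge cK0) _; exact: (le_outer_measure m).
  by rewrite muT lee_fin leNgt K00.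
- exact: outer_content_compact_lty.
Qed.

End content.

(** * Existence of Haar measure *)

(** By compactness of the segment the image filter has a cluster point, and an ultrafilter converges
    to each of its cluster points. *)
Lemma ultra_bounded_cvg (R : realType) (T : Type) (F : set_system T) (f : T -> R)
    (a b : R) : UltraFilter F ->
  (\forall t \near F, (a <= f t <= b)%R) -> cvg (f @ F).
Proof.
move=> UF fab.
have PF : ProperFilter (f @ F) by exact: fmap_proper_filter.
have [|p [_ clp]] := @segment_compact R a b (f @ F) PF.
  by apply: filterS fab => t /=; rewrite in_itv.
apply/cvg_ex; exists p => V Vp.
have [//|FnV] := in_ultra_setVsetC (f @^-1` V) UF.
have [|x [] //] := clp (~` V) V _ Vp.
exact: FnV.
Qed.

Lemma le_cvg_to (R : realType) (T : Type) (F : set_system T) (FF : ProperFilter F)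
    (f g : T -> R) (a b : R) : f @ F --> a -> g @ F --> b ->
  (\forall t \near F, (f t <= g t)%R) -> (a <= b)%R.
Proof.
move=> fa gb fg; rewrite -subr_ge0; apply: (cvgr_to_ge (cvgB gb fa)).
by apply: filterS fg => t; rewrite -subr_ge0.
Qed.

Section haar_existence.
Context (R : realType) (G : lcscGroupType).
Implicit Types (K L U : set G).

Section covering_index.
Local Open Scope group_scope.

Definition covered_by K U (n : nat) : Prop := exists s : seq G,
  (size s <= n)%N /\ forall x, K x -> exists2 g, g \in s & U (g^-1 * x).

(** Haar's covering number (K : U), with default value 0 when there is no finite cover. *)
Definition covering_index K U : nat :=
  if pselect (exists n, `[< covered_by K U n >]) is left e then ex_minn e else 0.

Lemma covering_index_le K U n : covered_by K U n -> (covering_index K U <= n)%N.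
Proof.
move=> KUn; rewrite /covering_index; case: pselect => [e|//].
by case: ex_minnP => m _; apply; exact/asboolP.
Qed.

Lemma covering_indexP K U : compact K -> nbhs (1 : G) U ->
  covered_by K U (covering_index K U).
Proof.
move=> cK U1; suff [n Kn] : exists n, covered_by K U n.
  rewrite /covering_index; case: pselect => [e|[]]; last by exists n; exact/asboolP.
  by case: ex_minnP => m /asboolP.
have : finite_subset_cover K (fun g => [set g * u | u in interior U]) K.
  move: (cK); rewrite compact_cover; apply.
    by move=> g _; apply: lmul_open; exact: open_interior.
  by move=> x Kx; exists x => //; exists 1; rewrite ?mulg1.
case=> D _ KD; exists (size (finmap.enum_fset D)), (finmap.enum_fset D).
  split=> // x /KD [g /= gD [u Uu <-]]; exists g => //.
  by rewrite mulKg; exact: interior_subset.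
Qed.

Lemma covering_index_sub K L U : compact L -> nbhs (1 : G) U -> K `<=` L ->
  (covering_index K U <= covering_index L U)%N.
Proof.
move=> cL U1 KL; apply: covering_index_le.
by have [s [sn sL]] := covering_indexP cL U1; exists s; split => // x /KL /sL.
Qed.

Lemma covering_indexU K L U : compact K -> compact L -> nbhs (1 : G) U ->
  (covering_index (K `|` L) U <= covering_index K U + covering_index L U)%N.
Proof.
move=> cK cL U1; apply: covering_index_le.
have [s [sn sK]] := covering_indexP cK U1; have [t [tn tL]] := covering_indexP cL U1.
exists (s ++ t); split; first by rewrite size_cat leq_add.
by move=> x [/sK|/tL] [g gs Ug]; exists g; rewrite // mem_cat gs ?orbT.
Qed.

(** Split the centres of an optimal cover of the union: those whose translate meets [K] cover [K],
    and the others must cover [L]. *)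
Lemma covering_index_disjoint K L U : compact K -> compact L -> nbhs (1 : G) U ->
  (forall g x y, K x -> L y -> U (g^-1 * x) -> U (g^-1 * y) -> False) ->
  (covering_index K U + covering_index L U <= covering_index (K `|` L) U)%N.
Proof.
move=> cK cL U1 sep; have [s [sn sKL]] := covering_indexP (compactU cK cL) U1.
apply: leq_trans sn.
pose a g := `[< exists2 x, K x & U (g^-1 * x) >].
rewrite -(count_predC a s) -!size_filter; apply: leq_add; apply: covering_index_le.
- exists [seq g <- s | a g]; split=> // x Kx; have [g gs Ug] := sKL x (or_introl Kx).
  by exists g => //; rewrite mem_filter gs andbT; apply/asboolP; exists x.
- exists [seq g <- s | predC a g]; split=> // x Lx.
  have [g gs Ug] := sKL x (or_intror Lx).
  exists g => //; rewrite mem_filter gs andbT /=.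
  by apply/asboolPn => -[y Ky Uy]; exact: sep Ky Lx Uy Ug.
Qed.

Lemma covering_index_lmul g K U : compact K -> nbhs (1 : G) U ->
  (covering_index [set (g * x)%g | x in K] U <= covering_index K U)%N.
Proof.
move=> cK U1; apply: covering_index_le.
have [s [sn sK]] := covering_indexP cK U1.
exists (map (fun x => g * x) s); rewrite size_map; split => // _ [x Kx <-].
have [h hs Uh] := sK x Kx; exists (g * h); first exact: map_f.
by rewrite invgM -mulgA mulKg.
Qed.

(** Taking [L] to be the reference set [K0] bounds the ratio (K : U) / (K0 : U) by (K : K0),
    independently of [U]. *)
Lemma covering_index_mul K L U : compact K -> compact L ->
  nbhs (1 : G) L -> nbhs (1 : G) U ->
  (covering_index K U <= covering_index K L * covering_index L U)%N.
Proof.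
move=> cK cL L1 U1; apply: covering_index_le.
have [s [sn sK]] := covering_indexP cK L1; have [t [tn tL]] := covering_indexP cL U1.
exists [seq g * h | g <- s, h <- t]; rewrite size_allpairs; split; first exact: leq_mul.
move=> x /sK [g gs /tL [h ht Uh]]; exists (g * h); first exact: allpairs_f.
by rewrite invgM -mulgA.
Qed.

Lemma covering_index_gt0 K U : compact K -> K !=set0 -> nbhs (1 : G) U ->
  (0 < covering_index K U)%N.
Proof.
move=> cK [x Kx] U1; have [s [sn /(_ x Kx)[g gs _]]] := covering_indexP cK U1.
by apply: leq_trans sn; case: s gs.
Qed.

End covering_index.

Local Open Scope ring_scope.

Lemma haar_exists :
  exists mu : {measure set (borel G) -> \bar R}, left_haar mu.
Proof.
have [K0 nK0 cK0] := compact_nbhs (1%g : G).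
have K00 : K0 !=set0 by exists 1%g; exact: nbhs_singleton.
have FP : ProperFilter (powerset_filter_from (nbhs (1%g : G))).
  exact: powerset_filter_from_filter.
(* Along an ultrafilter finer than the filter of small neighbourhoods of 1, the bounded ratios
   converge for all compact [K] simultaneously. *)
have [F [UF sF]] := ultraFilterLemma FP.
pose r K U : R := (covering_index K U)%:R / (covering_index K0 U)%:R.
have FU (P : set G -> Prop) :
    (exists2 U, nbhs (1%g : G) U & forall V, nbhs (1%g : G) V -> V `<=` U -> P V) ->
    \forall U \near F, P U.
  move=> [U U1 UP]; apply: (sF P).
  have := powerset_filter_fromP U1.
  by apply: (@filterS _ (powerset_filter_from _)) => V [V1 VU]; exact: UP.
have FT (P : set G -> Prop) :
    (forall V, nbhs (1%g : G) V -> P V) -> \forall U \near F, P U.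
  by move=> h; apply: FU; exists setT; [exact: filterT | move=> V V1 _; exact: h].
have pos U : nbhs (1%g : G) U -> 0 < (covering_index K0 U)%:R :> R.
  by move=> U1; rewrite ltr0n covering_index_gt0.
pose c K := lim (r K @ F).
have rc K : compact K -> r K @ F --> c K.
  move=> cK; apply: (@ultra_bounded_cvg R _ F _ 0 (covering_index K K0)%:R UF).
  apply: FT => V V1; rewrite divr_ge0//= ler_pdivrMr ?pos// -natrM ler_nat.
  exact: covering_index_mul.
have PF : ProperFilter F by exact: ultra_proper.
apply: (@left_haar_of_content R G c _ K0 cK0).
- split.
  + move=> K cK; apply: (le_cvg_to PF (cvg_cst _) (rc K cK)).
    by apply: FT => V V1; rewrite divr_ge0.
  + move=> K L cK cL KL; apply: (le_cvg_to PF (rc K cK) (rc L cL)).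
    apply: FT => V V1; rewrite ler_pM2r ?invr_gt0 ?pos// ler_nat.
    exact: covering_index_sub.
  + move=> K L cK cL.
    apply: (le_cvg_to PF (rc _ (compactU cK cL)) (cvgD (rc K cK) (rc L cL))).
    apply: FT => V V1; rewrite [leRHS](_ : _ = r K V + r L V)//.
    rewrite /r -mulrDl ler_pM2r ?invr_gt0 ?pos// -natrD ler_nat.
    exact: covering_indexU.
  + move=> K L cK cL KL0; have [U U1 sep] := compact_separated cK cL KL0.
    apply: (le_cvg_to PF (cvgD (rc K cK) (rc L cL)) (rc _ (compactU cK cL))).
    apply: FU; exists U => // V V1 VU.
    rewrite [leLHS](_ : _ = r K V + r L V)//.
    rewrite /r -mulrDl ler_pM2r ?invr_gt0 ?pos// -natrD ler_nat.
    apply: covering_index_disjoint => // g x y Kx Ly Vx Vy.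
    by apply: (sep g x y) => //; exact: VU.
  + move=> g K cK; apply: (le_cvg_to PF (rc _ (lmul_compact cK)) (rc K cK)).
    apply: FT => V V1; rewrite ler_pM2r ?invr_gt0 ?pos// ler_nat.
    exact: covering_index_lmul.
(* The ratio for [K0] itself is constantly 1, so the content does not vanish on [K0]. *)
- apply: lt_le_trans ltr01 _; apply: (le_cvg_to PF (cvg_cst _) (rc K0 cK0)).
  by apply: FT => V V1; rewrite /r divff// gt_eqF// pos.
Qed.

End haar_existence.

(** * Haar null sets *)

Section borel_sets.
Local Open Scope ring_scope.

Lemma open_borel (T : ptopologicalType) (A : set T) :
  open A -> measurable (A : set (borel T)).
Proof. exact: sub_sigma_algebra. Qed.

Lemma closed_borel (T : ptopologicalType) (A : set T) :
  closed A -> measurable (A : set (borel T)).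
Proof.
by move=> cA; rewrite -[A]setCK; apply: measurableC; apply: open_borel; exact: closed_openC.
Qed.

Lemma continuous_borel (T U : ptopologicalType) (f : T -> U) : continuous f ->
  measurable_fun [set: borel T] (f : borel T -> borel U).
Proof.
move=> /continuousP fo; apply: (@measurability _ _ (borel T) (borel U) _ _ (@open U)) => //.
by move=> _ [A oA <-]; rewrite setTI; apply: open_borel; exact: fo.
Qed.

(** Second countability writes [P] as a countable union of open rectangles; this places it in the
    product sigma-algebra, where Tonelli's theorem is available. *)
Lemma open_prod_borel (G : lcscGroupType) (P : set (G * G)) :
  open P -> measurable (P : set (borel G * borel G)).
Proof.
move=> oP; have [e [eo eb]] := countable_base G.
pose S n m : set (borel G * borel G) :=
  if pselect (e n `*` e m `<=` P) then e n `*` e m else set0.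
suff -> : P = \bigcup_n \bigcup_m S n m.
  apply: bigcupT_measurable => n; apply: bigcupT_measurable => m.
  rewrite /S; case: pselect => [_|_] /=; last exact: measurable0.
  by apply: measurableX; exact: open_borel.
apply/seteqP; split=> [[x y] Pxy|[x y] [n _ [m _]]]; last first.
  by rewrite /S; case: pselect => // eP /eP.
have : nbhs (x, y) P by exact: open_nbhs_nbhs.
case=> -[U1 U2] /= [/eb [n [enx enU]] /eb [m [emy emU]]] UP.
exists n => //; exists m => //; rewrite /S; case: pselect => //= -[] [a b] /= [ea eb'].
by apply: (UP (a, b)); split => /=; [exact: enU | exact: emU].
Qed.

End borel_sets.

(* Given a sigma-finiteness proof, the alias carries the canonical structure
   needed to form product measures. *)
Section sigma_finite_copy.
Local Open Scope ring_scope.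
Context d (T : measurableType d) (R : realType) (mu : {measure set T -> \bar R}).

Definition sigma_finite_copy (h : sigma_finite setT mu) : set T -> \bar R := mu.

Context (h : sigma_finite setT mu).

HB.instance Definition _ := Measure.on (sigma_finite_copy h).
HB.instance Definition _ :=
  Measure_isSigmaFinite.Build d T R (sigma_finite_copy h) h.

End sigma_finite_copy.

Section haar_null.
Local Open Scope ring_scope.
Context (R : realType) (G : lcscGroupType).
Implicit Types (A B Z : set G).

Lemma haar_nullU A B : haar_null R A -> haar_null R B -> haar_null R (A `|` B).
Proof. by move=> nA nB mu h; apply: negligibleU; [exact: nA | exact: nB]. Qed.

Lemma haar_nullS A B : A `<=` B -> haar_null R B -> haar_null R A.
Proof.
move=> AB nB mu h; have [E [mE E0 BE]] := nB mu h.
by exists E; split => //; exact: subset_trans BE. Qed.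

Lemma lmul_borel (g : G) A : measurable (A : set (borel G)) ->
  measurable ([set (g * x)%g | x in A] : set (borel G)).
Proof.
move=> mA; rewrite lmul_preimage -[X in measurable X]setTI.
exact: (continuous_borel (@continuous_lmul G g^-1%g)).
Qed.

Lemma haar_null_lmul (g : G) Z : haar_null R Z ->
  haar_null R [set (g * x)%g | x in Z].
Proof.
move=> nZ mu hmu; have [E [mE E0 ZE]] := nZ mu hmu.
exists ([set (g * x)%g | x in E]); split; [exact: lmul_borel | | exact: image_subset].
by have [_ _ ->] := hmu.
Qed.

(** Existence of Haar measure enters here: without one, every set would satisfy [haar_null]. *)
Lemma haar_null_neqT Z : haar_null R Z -> Z <> setT.
Proof.
move=> nZ ZT; have [mu hmu] := haar_exists R G.
have [E [mE E0 ZE]] := nZ mu hmu; have [+ _ _] := hmu; apply.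
by rewrite -E0; congr (mu _); apply/seteqP; split => // x _; apply: ZE; rewrite ZT.
Qed.

Lemma left_haar_sigma_finite (mu : {measure set (borel G) -> \bar R}) :
  left_haar mu -> sigma_finite setT mu.
Proof.
move=> [_ fin _]; have [K [cK KT]] := sigma_compact G.
exists K => // n; split; last exact: fin.
by apply: closed_borel; exact: compact_closedG.
Qed.

(** Apply Tonelli to the set [S] of pairs [(x, y)] with [x^-1 * y] in [E]. Its sections at fixed [x]
    are the null translates of [E]; those at fixed [y] are translates of the inverse of [E], all of
    the same measure. Were that measure nonzero, the whole group would be null. *)
Lemma haar_null_inv Z : haar_null R Z -> haar_null R [set x^-1%g | x in Z].
Proof.
move=> nZ mu hmu; have [E [mE E0 ZE]] := nZ mu hmu.
have [muT _ muL] := hmu.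
pose m : {sigma_finite_measure set (borel G) -> \bar R} :=
  sigma_finite_copy (left_haar_sigma_finite hmu).
pose S : set (borel G * borel G) := [set z | E (z.1^-1 * z.2)%g].
have cf : continuous (fun z : G * G => (z.1^-1 * z.2)%g).
  move=> z; apply: (@continuous_mulg G _ (fun z : G * G => z.1^-1%g) snd).
    by apply: continuous_invg; exact: cvg_fst.
  exact: cvg_snd.
have mS : measurable S.
  rewrite -[S]setTI.
  suff : measurable_fun setT
      (fun z : borel G * borel G => (z.1^-1 * z.2)%g : borel G) by apply.
  apply: (@measurability _ _ (borel G * borel G)%type (borel G) _ _ (@open G)) => //.
  move=> _ [ O oO <-]; rewrite setTI.
  have oS : open ((fun z : G * G => (z.1^-1 * z.2)%g) @^-1` O).
    by move/continuousP: cf; apply.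
  exact: open_prod_borel oS.
have S0 : (m \x m)%E S = 0%E.
  apply: integral0_eq => x _ /=.
  rewrite -E0 -(muL x E mE); congr (mu _); apply/seteqP; split=> [y|_ [y Ey <-]].
    by move/xsectionP => /= Ey; exists (x^-1 * y)%g; rewrite ?mulVKg.
  by apply/xsectionP; rewrite /S/= mulKg.
(* The measure built by integrating in the other order agrees with the first by uniqueness of
   product measures. *)
have : (m \x^ m)%E S = 0%E.
  rewrite -S0; apply/esym; apply: product_measure_unique => // A B mA mB.
  exact: product_measure2E.
move=> S20.
have mf := measurable_fun_ysection m mS.
have inull y : m (ysection S y) = mu [set x^-1%g | x in E].
  have mV : measurable ([set x^-1%g | x in E] : set (borel G)).
    rewrite invg_preimage -[X in measurable X]setTI.
    exact: (continuous_borel (@invg_continuous G)).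
  rewrite -(muL y _ mV); congr (mu _); apply/seteqP; split=> [x|_ [_ [x Ex <-] <-]].
    move/ysectionP => /= Ex; exists (y^-1 * x)%g; last by rewrite mulVKg.
    by exists (x^-1 * y)%g => //; rewrite invgM invgK.
  by apply/ysectionP; rewrite /S/= invgM invgK mulgVK.
exists ([set x^-1%g | x in E]); split; last exact: image_subset.
  rewrite invg_preimage -[X in measurable X]setTI.
  exact: (continuous_borel (@invg_continuous G)).
apply: contrapT => /eqP nz; apply: muT.
have [h _] := ae_eq_integral_abs m measurableT mf.
have [|N [mN N0 NE]] := h.
  by rewrite -S20; apply: eq_integral => y _; rewrite gee0_abs//= measure_ge0.
rewrite -N0; congr (mu _); apply/seteqP; split => // y _.
by apply: NE => /(_ Logic.I)/= /eqP; rewrite inull (negbTE nz).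
Qed.

End haar_null.

(** * Null sets of a closed subgroup give null product sets *)

Section product_null.
Local Open Scope ring_scope.
Context (R : realType) (K G : lcscGroupType) (k : K -> G) (B : set G).
Hypotheses (ke : closed_embedding k) (cB : closed B).
Hypothesis kB : forall x y b b', B b -> B b' -> (k x * b = k y * b')%g -> x = y.

Lemma image_mul_setC (C : set G) (S : set K) : C `<=` B ->
  (k @` ~` S) ** C = (range k ** C) `\` (k @` S ** C).
Proof.
move=> CB; apply/seteqP; split.
  move=> _ [_ [x nSx <-] [c Cc <-]]; split.
    by exists (k x) => //; exists c.
  move=> [_ [y Sy <-] [c' Cc' e]]; apply: nSx.
  by rewrite -(kB (CB _ Cc') (CB _ Cc) e).
move=> _ [[_ [x _ <-] [c Cc <-]] h]; exists (k x); last by exists c.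
by exists x => // Sx; apply: h; exists (k x) => //; exists c.
Qed.

Lemma image_mul_bigcup (C : set G) (S : nat -> set K) :
  (k @` (\bigcup_n S n)) ** C = \bigcup_n (k @` S n ** C).
Proof.
apply/seteqP; split=> [_ [_ [x [n _ Sx] <-] [c Cc <-]]|
    _ [n _ [_ [x Sx <-] [c Cc <-]]]].
  by exists n => //; exists (k x) => //; exists c.
by exists (k x); [exists x => //; exists n | exists c].
Qed.

(* The sets S with k(S) C Borel form a sigma-algebra because k(K) x C -> G is
   injective, and contain the closed sets because C is compact; so the
   Lusin-Souslin theorem is not needed. *)
Lemma image_mul_borel (C : set G) (S : set K) : compact C -> C `<=` B ->
  measurable (S : set (borel K)) -> measurable ((k @` S) ** C : set (borel G)).
Proof.
move=> cC CB; have [_ _ _ kcl] := ke.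
have mcl (F : set K) : closed F -> measurable ((k @` F) ** C : set (borel G)).
  by move=> cF; apply: closed_borel; apply: closed_mul_compact => //; exact: kcl.
pose M : set (set K) := [set S | measurable ((k @` S) ** C : set (borel G))].
have MC S' : M S' -> M (~` S').
  move=> MS; rewrite /M/= image_mul_setC//; apply: measurableD => //.
  by apply: mcl; exact: closedT.
suff : <<s @open K >> `<=` M by apply.
apply: smallest_sub.
  split=> [|A MA|F MF].
  - rewrite /M/= image_set0 (_ : set0 ** C = set0); first exact: measurable0.
    by apply/seteqP; split => // _ [? []].
  - by rewrite setTD; exact: MC.
  - by rewrite /M/= image_mul_bigcup; exact: bigcupT_measurable.
by move=> U oU; rewrite -[U]setCK; apply: MC; apply: mcl; exact: open_closedC.
Qed.

(** Over a compact piece [C n] of [B], [lam] is additive by the injectivity [kB], finite on compact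
    sets and left invariant; so it is zero or a Haar measure of [K], for which [Z] is null. *)
Lemma haar_null_image_mul (Z : set K) : haar_null R Z ->
  haar_null R ((k @` Z) ** B).
Proof.
move=> nZ mu hmu; have [muT fin muL] := hmu; have [km _ kc _] := ke.
have [C [cC CB]] := closed_sigma_compact cB.
have -> : (k @` Z) ** B = \bigcup_n ((k @` Z) ** C n).
  rewrite -CB; apply/seteqP.
  split=> [_ [a Za [b [n _ Cb] <-]]|_ [n _ [a Za [b Cb <-]]]].
    by exists n => //; exists a => //; exists b.
  by exists a => //; exists b => //; exists n.
apply: negligible_bigcup => n.
have CnB : C n `<=` B by rewrite -CB => x; exists n.
have mC (S : set (borel K)) : measurable S ->
    measurable ((k @` S) ** C n : set (borel G)).
  exact: image_mul_borel.
pose lam (S : set (borel K)) : \bar R := mu ((k @` S) ** C n).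
have lam0 : lam set0 = 0%E.
  rewrite /lam image_set0 (_ : set0 ** C n = set0) ?measure0//.
  by apply/seteqP; split => // _ [? []].
have lam_ge0 S : (0 <= lam S)%E by exact: measure_ge0.
have lam_add : semi_sigma_additive lam.
  move=> F mF tF mUF; rewrite /lam image_mul_bigcup.
  apply: measure_semi_sigma_additive => [i||].
  - by apply: mC; exact: mF.
  - apply/trivIsetP => i j _ _ ij; apply/seteqP; split => // x.
    move=> [[_ [a Fa <-] [c Cc <-]] [_ [a' Fa' <-] [c' Cc' e]]].
    have aa := kB (CnB _ Cc') (CnB _ Cc) e.
    have /trivIsetP/(_ i j Logic.I Logic.I ij) F0 := tF.
    have : (F i `&` F j) a by split => //; rewrite -aa.
    by rewrite F0.
  - by rewrite -image_mul_bigcup; exact: mC.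
pose nu : {measure set (borel K) -> \bar R} := HB.pack lam
  (isMeasure.Build _ _ _ lam lam0 lam_ge0 lam_add).
(* A zero measure is not a Haar measure, but then all of [range k ** C n] is null. *)
have [nuT|nuT] := eqVneq (nu setT) 0%E.
  exists (range k ** C n); split; [exact: mC | exact: nuT |].
  by move=> _ [_ [x _ <-] [c Cc <-]]; exists (k x) => //; exists c.
have hnu : left_haar nu.
  split=> [|S cS|g S mS]; first by move/eqP: nuT.
    apply: fin; apply: compact_mul => //; apply: continuous_compact => //.
    exact: continuous_subspaceT.
  rewrite /nu/= /lam -(muL (k g) _ (mC _ mS)).
  congr (mu _); apply/seteqP; split.
    move=> _ [_ [_ [x Sx <-] <-] [c Cc <-]]; exists (k x * c)%g.
      by exists (k x) => //; exists c.
    by rewrite km mulgA.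
  move=> _ [_ [_ [x Sx <-] [c Cc <-]] <-]; exists (k (g * x)%g).
    by exists (g * x)%g => //; exists x.
  by exists c => //; rewrite km mulgA.
have [E [mE E0 ZE]] := nZ nu hnu.
exists ((k @` E) ** C n); split; [exact: mC | exact: E0 |].
move=> _ [_ [x Zx <-] [c Cc <-]].
by exists (k x); [exists x => //; exact: ZE | exists c].
Qed.

End product_null.

(** * Matched pairs *)

Section subgroups.
Local Open Scope group_scope.
Context (K G : groupType).
Implicit Types (A B : set G).

Lemma morph_one (f : K -> G) : {morph f : x y / x * y} -> f 1 = 1.
Proof. by move=> fM; apply: (mulgI (f 1)); rewrite -fM !mulg1. Qed.

Lemma morph_inv (f : K -> G) x : {morph f : x y / x * y} -> f x^-1 = (f x)^-1.
Proof.
by move=> fM; apply: (mulgI (f x)); rewrite -fM !mulgV morph_one.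
Qed.

Lemma subgroup_image (f : K -> G) (A : set K) : {morph f : x y / x * y} ->
  subgroup A -> subgroup (f @` A).
Proof.
move=> fM [A1 AM AV]; split.
- by exists 1; rewrite ?morph_one.
- by move=> _ _ [x Ax <-] [y Ay <-]; exists (x * y); [exact: AM | exact: fM].
- by move=> _ [x Ax <-]; exists (x^-1); [exact: AV | exact: morph_inv].
Qed.

Lemma sub_generated A : A `<=` generated A.
Proof. exact: sub_gen_smallest. Qed.

Lemma generated_sub A B : subgroup B -> A `<=` B -> generated A `<=` B.
Proof. exact: smallest_sub. Qed.

Lemma generated_subgroup A : subgroup (generated A).
Proof.
split=> [B [[]//]|x y Ax Ay B BA|x Ax B BA].
- by have [[_ BM _] _] := BA; apply: BM; [exact: Ax | exact: Ay].
- by have [[_ _ BV] _] := BA; apply: BV; exact: Ax.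
Qed.

Lemma generated_id A : subgroup A -> generated A = A.
Proof.
by move=> sA; apply/seteqP; split; [exact: generated_sub | exact: sub_generated].
Qed.

Lemma subgroup_mul A B : subgroup A -> subgroup B -> normalizes B A ->
  subgroup (A ** B).
Proof.
move=> [A1 AM AV] [B1 BM BV] nBA; split.
- by exists 1 => //; exists 1; rewrite ?mulg1.
- move=> _ _ [a Aa [b Bb <-]] [a' Aa' [b' Bb' <-]].
  exists (a * (b * a' * b^-1)); first by apply: AM => //; exact: nBA.
  by exists (b * b'); [exact: BM | rewrite -!mulgA mulKg].
- move=> _ [a Aa [b Bb <-]].
  exists (b^-1 * a^-1 * b^-1^-1); first by apply: nBA; [exact: BV | exact: AV].
  by exists (b^-1); [exact: BV | rewrite invgM mulgVK].
Qed.

(** Once [generated B] normalizes [A], the product set is itself a subgroup. *)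
Lemma generatedU A B : subgroup A -> normalizes (generated B) A ->
  generated (A `|` B) = A ** generated B.
Proof.
move=> sA nBA; have sB := generated_subgroup B.
apply/seteqP; split.
  apply: generated_sub; first exact: subgroup_mul.
  have [A1 _ _] := sA; have [B1 _ _] := sB.
  move=> x [Ax|Bx]; first by exists x => //; exists 1; rewrite ?mulg1.
  by exists 1 => //; exists x; rewrite ?mul1g//; exact: sub_generated.
have [_ gM _] := generated_subgroup (A `|` B).
move=> _ [a Aa [b Bb <-]]; apply: gM; first by apply: sub_generated; left.
apply: generated_sub b Bb; first exact: generated_subgroup.
by move=> b Bb; apply: sub_generated; right.
Qed.

(** The element [k (y^-1 * x) = b' * b^-1] lies in the trivial intersection. *)
Lemma trivial_mul_inj (k : K -> G) B x y b b' : {morph k : x y / x * y} ->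
  injective k -> subgroup B -> B `&` range k = [set 1] ->
  B b -> B b' -> k x * b = k y * b' -> x = y.
Proof.
move=> kM kI [_ BM BV] Bk1 Bb Bb' e.
have e' : k (y^-1 * x) = b' * b^-1.
  by rewrite kM morph_inv//; apply: (mulIg b); rewrite mulgVK -mulgA e mulKg.
have : (B `&` range k) (b' * b^-1).
  by split; [apply: BM => //; exact: BV | exists (y^-1 * x)].
rewrite Bk1 -e' /= -(morph_one kM) => /kI yx.
by apply: (mulgI y^-1); rewrite yx mulVg.
Qed.

End subgroups.

Lemma generated_image (K G : groupType) (f : K -> G) (A : set K) :
  {morph f : x y / (x * y)%g} -> generated (f @` A) = f @` generated A.
Proof.
move=> fM; apply/seteqP; split.
  apply: generated_sub; first by apply: subgroup_image => //; exact: generated_subgroup.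
  by apply: image_subset; exact: sub_generated.
suff h : generated A `<=` f @^-1` generated (f @` A) by move=> _ [x /h + <-].
apply: generated_sub; last by move=> x Ax; apply: sub_generated; exists x.
have [g1 gM gV] := generated_subgroup (f @` A).
split=> [|x y|x]; rewrite /preimage/=.
- by rewrite morph_one.
- by rewrite fM; exact: gM.
- by rewrite morph_inv//; exact: gV.
Qed.

Lemma image_bigsetU_seq (I T U : Type) (f : T -> U) (F : I -> set T) (s : seq I) :
  f @` (\big[setU/set0]_(i <- s) F i) = \big[setU/set0]_(i <- s) (f @` F i).
Proof.
by elim: s => [|i s IH]; rewrite ?big_nil ?image_set0// !big_cons image_setU IH.
Qed.

(** * Closed subgroups and closedness of products in a matched pair *)

Section closed_subgroups.
Local Open Scope group_scope.

Lemma closed_embedding_subgroup (K G : preTopologicalGroupType) (f : K -> G)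
    (A : set K) : closed_embedding f -> closed_subgroup A -> closed_subgroup (f @` A).
Proof.
by move=> [fM _ _ fc] [sA cA]; split; [exact: subgroup_image | exact: fc].
Qed.

Lemma closed_subgroup_setT (G : preTopologicalGroupType) : closed_subgroup [set: G].
Proof. by split => //; exact: closedT. Qed.

Lemma closed_embedding_comp (K H G : preTopologicalGroupType)
    (f : H -> G) (g : K -> H) :
  closed_embedding f -> closed_embedding g -> closed_embedding (f \o g).
Proof.
move=> [fM fI fc fcl] [gM gI gc gcl]; split.
- by move=> x y; rewrite /= gM fM.
- exact: inj_comp.
- by move=> x; apply: continuous_comp; [exact: gc | exact: fc].
- by move=> A cA; rewrite -image_comp; apply: fcl; exact: gcl.
Qed.

(* The closure L of Q P normalizes Q. For x in L the conull sets Q G' and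
   x Q G' = Q x G' meet, so L is contained in Q G' and L = Q (L `&` G'). *)
Lemma closed_matched_mul (R : realType) (H : lcscGroupType) (Q G' P : set H) :
  matched_pair R Q G' -> closed_subgroup P -> P `<=` G' -> normalizes P Q ->
  closed (Q ** P).
Proof.
move=> [[sQ cQ] [sG cG] QG1 fQG] [sP cP] PG nPQ.
have [Q1 QM QV] := sQ; have [G1 GM GV] := sG; have [P1 PM PV] := sP.
pose L := closure (Q ** P).
have sL : subgroup L by apply: closure_subgroup; exact: subgroup_mul.
have QPL : Q ** P `<=` L by exact: subset_closure.
have QL : Q `<=` L by move=> q Qq; apply: QPL; exists q => //; exists 1; rewrite ?mulg1.
have PL : P `<=` L by move=> p Pp; apply: QPL; exists 1 => //; exists p; rewrite ?mul1g.
have [L1 LM LV] := sL.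
(* For fixed [y], conjugating [y] into the closed set [Q] is a closed condition, and it holds on
   [Q ** P]. *)
have nLQ : normalizes L Q.
  move=> x y Lx Qy.
  have c : continuous (fun z : H => z * y * z^-1).
    move=> z; apply: (@continuous_mulg H _ (fun z => z * y) (fun z => z^-1)).
      exact: continuous_rmul.
    exact: invg_continuous.
  have cS : closed ((fun z : H => z * y * z^-1) @^-1` Q).
    by apply: preimage_closed => // z _; exact: c.
  apply: cS; apply: closureS Lx => _ [q Qq [p Pp <-]] /=.
  have -> : q * p * y * (q * p)^-1 = q * (p * y * p^-1) * q^-1.
    by rewrite invgM !mulgA.
  by apply: (QM); [apply: QM => //; exact: nPQ | exact: QV].
have LQG : L `<=` Q ** G'.
  move=> x Lx.
  have [z [zX zxX]] : exists z, (Q ** G') z /\ (Q ** G') (x^-1 * z).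
    apply: contrapT => h.
    apply: (@haar_null_neqT R H (~` (Q ** G') `|` [set x * y | y in ~` (Q ** G')])).
      by apply: haar_nullU => //; exact: haar_null_lmul.
    apply/seteqP; split => // z _.
    have [zX|] := pselect ((Q ** G') z); last by left.
    right; exists (x^-1 * z); last by rewrite mulVKg.
    by move=> zxX; apply: h; exists z.
  move: zX zxX => [q Qq [g Gg qgz]] [q' Qq' [g' Gg' e]].
  (* Solve [q * g = x * (q' * g')] for [x], after moving [x] past [q'] by means of [nLQ]. *)
  exists (x * q'^-1 * x^-1 * q); first by apply: QM => //; apply: nLQ => //; exact: QV.
  exists (g * g'^-1); first by apply: GM => //; exact: GV.
  have ez : z = x * (q' * g') by rewrite e mulVKg.
  by rewrite -!mulgA (mulgA q) qgz ez !mulgA mulgVK mulgVK mulgK.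
pose M := L `&` G'.
have sM : closed_subgroup M.
  split; last by apply: closedI => //; exact: closed_closure.
  split=> [|x y [Lx Gx] [Ly Gy]|x [Lx Gx]]; first by [].
  - by split; [exact: LM | exact: GM].
  - by split; [exact: LV | exact: GV].
have QML : Q ** M = L.
  apply/seteqP; split=> [_ [q Qq [m [Lm _] <-]]|x Lx].
    by apply: LM => //; exact: QL.
  have [q Qq [g Gg qgx]] := LQG x Lx; exists q => //; exists g => //; split => //.
  rewrite (_ : g = q^-1 * x); last by rewrite -qgx mulKg.
  by apply: LM => //; apply: LV; exact: QL.
apply: (@closed_product H Q M P) => //.
- apply/seteqP; split=> [x [Qx [_ Gx]]|_ ->]; last by [].
  by rewrite -QG1.
- by rewrite QML; exact: closed_closure.
- by rewrite QML.
- by move=> x y [Lx _]; exact: nLQ.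
- by move=> x Px; split; [exact: PL | exact: PG].
Qed.

End closed_subgroups.

(** * The induction step for matched pairs *)

Section matched_pairs.
Local Open Scope group_scope.
Context (R : realType).

(** [haar_null_image_mul] treats null sets standing on the left of [Q]; inversion exchanges the two
    sides and preserves null sets. *)
Lemma full_measure_matched_mul (H G' : lcscGroupType) (k : G' -> H) (Q : set H)
    (E : set G') : closed_embedding k -> matched_pair R Q (range k) ->
  full_measure R E -> full_measure R (Q ** (k @` E)).
Proof.
move=> ke [[sQ cQ] [_ _] Qk1 fQk] fE; have [kM kI _ _] := ke.
have [_ _ QV] := sQ.
have nZ : haar_null R (Q ** (k @` ~` E)).
  apply: haar_nullS (haar_null_inv (haar_null_image_mul ke cQ _ (haar_null_inv fE))).
    move=> _ [q Qq [_ [x Ex <-] <-]]; exists (k x^-1 * q^-1); last first.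
      by rewrite invgM invgK (morph_inv _ kM) invgK.
    exists (k x^-1); first by exists (x^-1) => //; exists x.
    by exists (q^-1) => //; exact: QV.
  by move=> x y b b'; exact: trivial_mul_inj.
apply: haar_nullS (haar_nullU fQk nZ) => x nx.
have [[q Qq [_ [y _ <-] e]]|] := pselect ((Q ** range k) x); last by left.
right; exists q => //; exists (k y) => //; exists y => // Ey; apply: nx.
by exists q => //; exists (k y) => //; exists y.
Qed.

Lemma semidirect_normal (G H V : lcscGroupType) (act : autAction H V)
    (i : H -> G) (j : V -> G) : semidirect act i j ->
  normalizes [set: G] (range j).
Proof.
move=> [[_ je] ijc _ ijT] g x _.
have [_ jM jV] := (closed_embedding_subgroup je (closed_subgroup_setT V)).1.
have : [set a * b | a in range i & b in range j] g by rewrite ijT.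
move=> [_ [a _ <-] [b jb <-]] jx.
have [v _ ev] : range j (b * x * b^-1) by apply: (jM); [exact: jM | exact: jV].
by exists (act a v) => //; rewrite -ijc ev invgM !mulgA.
Qed.

(** Passes from a matched pair of [G'] to one of [G]. The normal factor [range j] is put first, the
    order in which [closed_product] and [generatedU] apply. *)
Lemma matched_pair_step (G H V G' : lcscGroupType) (act : autAction H V)
    (i : H -> G) (j : V -> G) (k : G' -> H) (Q : set H) (P N : set G') :
  semidirect act i j -> closed_embedding k -> matched_pair R Q (range k) ->
  matched_pair R P N -> normalizes (k @` P) Q ->
  matched_pair R (i @` (Q ** (k @` P))) (range j ** ((i \o k) @` N)).
Proof.
move=> sd ke mQ [[sP cP] [sN cN] PN1 fPN] nPQ.
have [[ie je] _ ij1 ijT] := sd.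
have [iM iI ic icl] := ie; have [jM jI jc jcl] := je; have [kM kI kc kcl] := ke.
have [[sQ cQ] [sk ck] Qk1 fQk] := mQ.
have sri := closed_embedding_subgroup ie (closed_subgroup_setT H).
have srj := closed_embedding_subgroup je (closed_subgroup_setT V).
have jN g x : range j x -> range j (g * x * g^-1) := semidirect_normal sd I.
have ke' := closed_embedding_comp ie ke.
have sN' := closed_embedding_subgroup ke' (conj sN cN : closed_subgroup N).
have jiT : range j ** range i = [set: G].
  apply/seteqP; split => // x _.
  have : [set a * b | a in range i & b in range j] x by rewrite ijT.
  move=> [a ia [b jb <-]]; exists (a * b * a^-1); first exact: jN.
  by exists a => //; rewrite mulgVK.
have csP : closed_subgroup (i @` (Q ** (k @` P))).
  apply: (closed_embedding_subgroup ie); split.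
    by apply: subgroup_mul => //; exact: subgroup_image.
  apply: (closed_matched_mul mQ) => //; last by move=> _ [x _ <-]; exists x.
  exact: closed_embedding_subgroup.
have csN : closed_subgroup (range j ** ((i \o k) @` N)).
  split.
    by apply: subgroup_mul => [||x y _]; [exact: srj.1 | exact: sN'.1 | exact: jN].
  (* The ambient product [range j ** range i] is all of [G], hence trivially closed. *)
  apply: (closed_product srj sri).
  - by rewrite setIC.
  - by rewrite jiT; exact: closedT.
  - by rewrite jiT.
  - by move=> x y _; exact: jN.
  - exact: sN'.2.
  - by move=> _ [x _ <-]; exists (k x).
split=> //.
- apply/seteqP; split=> [x|_ ->]; last first.
    by have [[? _ _] _] := csP; have [[? _ _] _] := csN.
  (* Trivial intersections are used in [G], then in [H], then in [G']: they give [j v = 1], then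
     [q = 1], and finally [p = n = 1]. *)
  move=> [[_ [q Qq [_ [p Pp <-] <-]] <-] [_ [v _ <-] [_ [n Nn <-] /= e]]].
  have ejv : j v = i (q * k p * (k n)^-1).
    by rewrite iM morph_inv//; apply: (mulIg (i (k n))); rewrite mulgVK.
  have : (range i `&` range j) (j v).
    by split; [rewrite ejv; exists (q * k p * (k n)^-1) | exists v].
  rewrite ij1 /= => jv1; move: ejv; rewrite jv1 -(morph_one iM) => /iI e1.
  have eq : q = k (n * p^-1).
    rewrite kM morph_inv//; apply: (mulIg (k p)); rewrite mulgVK.
    by apply: (mulIg (k n)^-1); rewrite mulgV.
  have : (Q `&` range k) q by split => //; rewrite eq; exists (n * p^-1).
  rewrite Qk1 /= => q1; move: eq; rewrite q1 -(morph_one kM) => /kI np.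
  have en : n = p by apply: (mulIg p^-1); rewrite mulgV.
  have : (P `&` N) p by split => //; rewrite -en.
  by rewrite PN1 /= => ->; rewrite (morph_one kM) mulg1 morph_one.
- have fY := full_measure_matched_mul ke mQ fPN.
  have inj x y b b' : range j b -> range j b' -> i x * b = i y * b' -> x = y.
    by apply: (trivial_mul_inj iM iI srj.1); rewrite setIC.
  (* Outside the product of the two subgroups, the [H]-component lies in the null complement from
     [fY]. *)
  apply: haar_nullS (haar_null_image_mul ie srj.2 inj fY) => x nx.
  have : [set a * b | a in range i & b in range j] x by rewrite ijT.
  move=> [_ [h _ <-] [b jb e]]; exists (i h); last by exists b.
  exists h => // -[q Qq [_ [_ [p Pp [n Nn <-]] <-] eh]]; apply: nx.
  exists (i (q * k p)).
    by exists (q * k p) => //; exists q => //; exists (k p) => //; exists p.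
  exists (i (k n) * b); last by rewrite -e -eh kM !iM !mulgA.
  (* Normality of [range j] allows [b] to be moved in front of [i (k n)]. *)
  exists (i (k n) * b * (i (k n))^-1); first exact: jN.
  by exists (i (k n)); [exists n | rewrite mulgVK].
Qed.

End matched_pairs.

(** * Induction on the depth of the dual orbit condition *)

Theorem proposition1p10 (R : realType) (l : nat) (G H V : lcscGroupType)
    (act : autAction H V) (i : H -> G) (j : V -> G) (Q W : seq (set H)) :
  (1 <= l)%N ->
  semidirect act i j ->
  DOC R l act Q W ->
  let P := generated (\big[setU/set0]_(A <- Q) (i @` A)) in
  let N := generated (range j `|` \big[setU/set0]_(A <- W) (i @` A)) in
  matched_pair R P N.
Proof.
elim: l G H V act i j Q W => [//|l IH] G H V act i j Q W _ sd.
move: (sd) => [[ie je] conj ij1 ijT].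
have sri := closed_embedding_subgroup ie (closed_subgroup_setT H).
have srj := closed_embedding_subgroup je (closed_subgroup_setT V).
case: l IH => [|l] IH [_ _ _].
  (* In depth 1 the two groups are [range i] and [range j], whose product is all of [G]. *)
  move=> [_ -> ->] /=; rewrite big_seq1 big_nil setU0.
  rewrite (generated_id sri.1) (generated_id srj.1); split => //.
  by rewrite ijT /full_measure setCT => mu _; exact: negligible_set0.
move=> [xi0 [G' [H' [V' [act' [k [i' [j' [Q0 [Q' [W' [[_ ke _ sd'] [mQ nQ] D' -> ->]]]]]]]]]]]].
have := IH _ _ _ _ _ _ _ _ isT sd' D'; move: D' => _ /=.
set SP := \big[setU/set0]_(A <- Q') _; set SW := \big[setU/set0]_(A <- W') _.
move=> mPN.
have [iM _ _ _] := ie; have [kM _ _ _] := ke.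
have ikM : {morph i \o k : x y / (x * y)%g} by move=> x y; rewrite /= kM iM.
(* The deeper subgroups reach [G] along [i'], then [k], then [i]; factoring out [i \o k] exhibits
   the sets to which the induction hypothesis refers in [G']. *)
have big_image (s : seq (set H')) :
    \big[setU/set0]_(A <- [seq (k \o i') @` A | A <- s]) (i @` A) =
    (i \o k) @` (\big[setU/set0]_(A <- s) (i' @` A)).
  rewrite image_bigsetU_seq big_map; apply: eq_bigr => A _.
  by rewrite !image_comp.
rewrite !big_cons !big_image -/SP -/SW.
(* The deeper [Q'] all lie in [H'], which normalizes [Q0], and so does the group they generate. *)
have nPQ : normalizes (k @` generated SP) Q0.
  suff h : generated SP `<=` range i'.
    by move=> _ y [x /h [z _ <-] <-]; apply: nQ; exists z.
  apply: generated_sub.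
    by move: sd' => [[[iM' _ _ _] _] _ _ _]; exact: subgroup_image.
  by rewrite /SP -image_bigsetU_seq; exact: image_subset.
have eP : generated (i @` Q0 `|` (i \o k) @` SP) = i @` (Q0 ** (k @` generated SP)).
  have [[sQ _] _ _ _] := mQ.
  rewrite -image_comp -image_setU generated_image// generatedU ?generated_image//.
have eN : generated (range j `|` (i @` range (k \o j') `|` (i \o k) @` SW)) =
    range j ** ((i \o k) @` generated (range j' `|` SW)).
  rewrite (_ : i @` range (k \o j') = (i \o k) @` range j'); last by rewrite !image_comp.
  rewrite -image_setU generatedU ?generated_image//; first exact: srj.1.
  by move=> x y _; exact: (semidirect_normal sd I).
by rewrite eP eN; apply: matched_pair_step.
Qed.
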